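(* Let $G$ and $H$ be two connected graphs having $n_1$ and $n_2$ vertices respectively. Then $\chi_s(G \times H) \leq \min\{n_1\, \chi_s(H),\ n_2\, \chi_s(G)\}$.
   Context: All graphs are undirected, finite and simple. A $k$-star coloring of a graph $G$ is a proper vertex coloring of $G$ with colors from $\{1,\dots,k\}$ such that every path on four vertices in $G$ (as a not necessarily induced subgraph) uses at least three distinct colors. The star chromatic number $\chi_s(G)$ is the smallest integer $k$ such that $G$ has a $k$-star coloring. The tensor product $G \times H$ is the graph with vertex set $V(G)\times V(H)$ in which $(u,v)$ and $(u',v')$ are adjacent if and only if $uu'\in E(G)$ and $vv'\in E(H)$. *)

(* Defs.v *)
From mathcomp Require Import all_boot.

Set Implicit Arguments.
Unset Strict Implicit.
Unset Printing Implicit Defensive.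

Record sgraph := SGraph {
  vertex :> finType;
  adj : rel vertex;
  adj_sym : symmetric adj;
  adj_irrefl : irreflexive adj
}.

(* The null graph does not count as connected. *)
Definition connected (G : sgraph) : bool :=
  (0 < #|G|) && [forall x : G, forall y : G, connect (@adj G) x y].

Section TensorProduct.
Variables G H : sgraph.

Definition tensor_adj : rel (G * H)%type :=
  fun p q => adj p.1 q.1 && adj p.2 q.2.

Lemma tensor_adj_sym : symmetric tensor_adj.
Proof.
by move=> p q; rewrite /tensor_adj (adj_sym p.1) (adj_sym p.2).
Qed.

Lemma tensor_adj_irrefl : irreflexive tensor_adj.
Proof. by move=> p; rewrite /tensor_adj adj_irrefl. Qed.

Definition tensor : sgraph := SGraph tensor_adj_sym tensor_adj_irrefl.

End TensorProduct.

Section StarColoring.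
Variable G : sgraph.

Definition proper_coloring k (c : {ffun G -> 'I_k}) : bool :=
  [forall x : G, forall y : G, adj x y ==> (c x != c y)].

(* Only consecutive vertices of the tuple are required to be adjacent: the
   path need not be induced. *)
Definition is_path4 (p : 4.-tuple G) : bool := uniq p && sorted (@adj G) p.

Definition star_coloring k (c : {ffun G -> 'I_k}) : bool :=
  proper_coloring c &&
  [forall p : 4.-tuple G, is_path4 p ==> (3 <= #|[set c x | x in p]|)].

Definition star_colorable (k : nat) : bool :=
  [exists c : {ffun G -> 'I_k}, star_coloring c].

Lemma star_colorable_card : star_colorable #|G|.
Proof.
have inj_c : injective [ffun x : G => enum_rank x].
  by move=> x y; rewrite !ffunE; apply: enum_rank_inj.
apply/existsP; exists [ffun x => enum_rank x]; apply/andP; split.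
  apply/forallP=> x; apply/forallP=> y; apply/implyP=> xy.
  by apply: contraTneq xy => /inj_c ->; rewrite adj_irrefl.
apply/forallP=> p; apply/implyP=> /andP[/card_uniqP card_p _].
by rewrite card_imset // card_p size_tuple.
Qed.

Definition star_chromatic : nat :=
  ex_minn (ex_intro star_colorable _ star_colorable_card).

End StarColoring.

(* Main.v *)
Require Import Defs.
From mathcomp Require Import all_boot.

Set Implicit Arguments.
Unset Strict Implicit.
Unset Printing Implicit Defensive.

(** Given a star coloring [c] of [H], color the vertex [(u, v)] of the product
    by [(u, c v)].  The first component alone makes this proper, since adjacent
    vertices have adjacent, hence distinct, first coordinates.  A properly
    colored path on four vertices has at most two colors only if its colors
    alternate.  In that case the first coordinates alternate too, so the second
    coordinates of the first and third vertices must differ, and likewise those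
    of the second and fourth: the path projects to a path of [H] whose colors
    under [c] alternate, which is impossible.

    The argument uses the product only through its two projections, which are
    homomorphisms and jointly injective.  Lemma [star_chromatic_mul] is stated
    for any graph with two such maps; applying it to the projections in one
    order and then in the other gives the two bounds. *)

(** Star colorings phrased without tuples and cardinals, with colors in an
    arbitrary type so that pairs may serve as colors.  The endpoints [x], [t]
    of an alternating walk differ automatically, by properness. *)
Definition is_star_coloring (G : sgraph) (T : Type) (c : G -> T) : Prop :=
  (forall x y, adj x y -> c x <> c y) /\
  (forall x y z t, adj x y -> adj y z -> adj z t -> x != z -> y != t ->
     c x = c z -> c y <> c t).

Lemma star_coloringP (G : sgraph) k (c : {ffun G -> 'I_k}) :
  reflect (is_star_coloring c) (star_coloring c).
Proof.
apply: (iffP andP) => [[/forallP prop_c /forallP star_c] | [prop_c alt_c]].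
  have proper x y : adj x y -> c x != c y.
    by move/forallP/(_ y)/implyP: (prop_c x).
  split=> [x y /proper/eqP // | x y z t xy yz zt xz yt cxz cyt].
  have neq u v : adj u v -> u != v.
    by apply: contraTneq => ->; rewrite adj_irrefl.
  have xt : x != t.
    by apply: contraTneq (proper _ _ xy) => ->; rewrite negbK cyt.
  have := star_c [tuple x; y; z; t].
  rewrite /is_path4 /= !inE !negb_or xy yz zt xz yt xt !neq //=.
  apply/negP; rewrite -ltnNge ltnS (@leq_trans #|[set c x; c y]|) //.
    apply/subset_leq_card/subsetP=> _ /imsetP[u + ->].
    by rewrite !inE => /or4P[] /eqP->; rewrite -?cxz -?cyt eqxx ?orbT.
  by rewrite cards2; case: (_ != _).
split.
  apply/forallP=> x; apply/forallP=> y; apply/implyP=> xy.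
  by apply/eqP; apply: prop_c.
have three (p : 4.-tuple G) u v w : adj u v -> adj v w -> c u != c w ->
    {subset [:: u; v; w] <= p} -> 2 < #|[set c a | a in p]|.
  move=> uv vw cuw sub_p.
  have uniq_c : uniq [:: c u; c v; c w].
    rewrite /= !inE negb_or cuw !andbT.
    by apply/andP; split; apply/eqP; apply: prop_c.
  rewrite -[leqLHS]/(size [:: c u; c v; c w]) -(card_uniqP uniq_c).
  apply/subset_leq_card/subsetP=> _ /(mapP (s := [:: u; v; w]))[a a_in ->].
  exact/imset_f/sub_p.
apply/forallP=> -[[|x [|y [|z [|t [|? ?]]]]] //= sz].
apply/implyP; rewrite /is_path4 /= !inE !negb_or.
case/andP=> /and4P[/and3P[_ xz _] /andP[_ yt] _ _] /and4P[xy yz zt _].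
(* Without alternation, either the first three vertices or the last three
   have pairwise distinct colors. *)
have [cxz | cxz] := eqVneq (c x) (c z).
  apply: (three _ y z t) => //; first exact/eqP/(alt_c x y z t).
  by move=> a; rewrite !inE => /or3P[] ->; rewrite ?orbT.
apply: (three _ x y z) => // a.
by rewrite !inE => /or3P[] ->; rewrite ?orbT.
Qed.

Lemma star_chromatic_min (G : sgraph) (T : finType) (c : G -> T) :
  is_star_coloring c -> star_chromatic G <= #|T|.
Proof.
move=> [prop_c alt_c]; rewrite /star_chromatic.
case: ex_minnP => m _; apply; apply/existsP.
exists [ffun x => enum_rank (c x)]; apply/star_coloringP.
split=> [x y xy | x y z t xy yz zt xz yt]; rewrite !ffunE.
  by move/enum_rank_inj; apply: prop_c.
by move/enum_rank_inj=> cxz /enum_rank_inj; apply: (alt_c x y z t).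
Qed.

Lemma star_chromatic_witness (G : sgraph) :
  exists c : G -> 'I_(star_chromatic G), is_star_coloring c.
Proof.
rewrite /star_chromatic; case: ex_minnP => m /existsP[c /star_coloringP ?] _.
by exists c.
Qed.

(** Two jointly injective homomorphisms say that [K] is isomorphic to a
    subgraph of the tensor product of [G] and [H]; this form is symmetric in
    the two factors, so that no commutativity isomorphism is needed. *)
Lemma star_chromatic_mul (K G H : sgraph) (f : K -> G) (g : K -> H) :
    {homo f : p q / adj p q} -> {homo g : p q / adj p q} ->
    injective (fun p => (f p, g p)) ->
  star_chromatic K <= #|G| * star_chromatic H.
Proof.
move=> homf homg inj_fg; have [c [prop_c alt_c]] := star_chromatic_witness H.
rewrite -[star_chromatic H]card_ord -card_prod.
apply: (star_chromatic_min (c := fun p => (f p, c (g p)))).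
split=> [p q /homf pq [fpq _] | p q r s pq qr rs pr qs [fpr cpr] [fqs]].
  by move: pq; rewrite fpq adj_irrefl.
have g_neq a b : a != b -> f a = f b -> g a != g b.
  by move=> ab fab; apply: contra_neq ab => gab; apply: inj_fg; rewrite fab gab.
by apply: (alt_c (g p) (g q) (g r) (g s)); rewrite ?homg ?g_neq.
Qed.

Theorem theorem1 (G H : sgraph) (n1 n2 : nat)
    (connG : connected G) (connH : connected H)
    (cardG : #|G| = n1) (cardH : #|H| = n2) :
  star_chromatic (tensor G H) <=
    minn (n1 * star_chromatic H) (n2 * star_chromatic G).
Proof.
have hom1 : {homo (fun p : tensor G H => p.1) : p q / adj p q}.
  by move=> p q /andP[].
have hom2 : {homo (fun p : tensor G H => p.2) : p q / adj p q}.
  by move=> p q /andP[].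
rewrite -cardG -cardH leq_min.
rewrite (star_chromatic_mul hom1 hom2) => [|[u v] [u' v'] //].
by rewrite (star_chromatic_mul hom2 hom1) // => -[u v] [u' v'] [-> ->].
Qed.
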